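(* Let $1\le m\le n$ and consider the polynomial $p(z)=1-m^{m/2}z_1\cdots z_m$ on $\mathbb C^n$. Then $p$ is not cyclic in $D_\alpha(\mathbb B_n)$ whenever $\alpha>\frac{2n+1-m}{2}$.
   Context: $\mathbb B_n$ is the Euclidean unit ball of $\mathbb C^n$. For $\alpha\in\mathbb R$, the Dirichlet-type space $D_\alpha(\mathbb B_n)$ is the Hilbert space of all holomorphic $f(z)=\sum_k a_kz^k$ on $\mathbb B_n$ (sum over multi-indices $k$ of non-negative integers, $|k|=k_1+\dots+k_n$, $k!=k_1!\cdots k_n!$) with $$\|f\|_\alpha^2:=\sum_{k}(n+|k|)^\alpha\frac{(n-1)!\,k!}{(n-1+|k|)!}|a_k|^2<\infty .$$ A function $f\in D_\alpha(\mathbb B_n)$ is cyclic if the closed linear span in $D_\alpha(\mathbb B_n)$ of $\{z_1^{k_1}\cdots z_n^{k_n}f: k_1,\dots,k_n=0,1,\dots\}$ equals $D_\alpha(\mathbb B_n)$. *)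

(* Defs.v *)
(* The complex numbers are R[i], over an arbitrary R : realType. *)
From HB Require Import structures.
From mathcomp Require Import all_boot all_order all_algebra.
From mathcomp Require Import all_classical all_reals all_analysis.
From mathcomp Require Import complex.
From mathcomp.analysis.showcase Require summability.

Set Implicit Arguments.
Unset Strict Implicit.
Unset Printing Implicit Defensive.

Import Order.TTheory GRing.Theory Num.Theory.
Import numFieldNormedType.Exports.

Local Open Scope classical_set_scope.
Local Open Scope ring_scope.
Local Open Scope complex_scope.

(* A function on the unit ball is represented by a total function on C^n, the
   values of which outside the ball are never used. R[i]^o is the alias of R[i]
   that carries the topology and the structure of normed module over R[i]. *)
Definition cfun (R : realType) (n : nat) : Type := 'rV[R[i]^o]_n -> R[i]^o.

Notation multiindex n := {ffun 'I_n -> nat}.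

Section DirichletTypeSpace.
Context {R : realType} {n : nat}.
Implicit Types (a : multiindex n -> R[i]) (k : multiindex n).
Implicit Types (f g h : cfun R n) (z : 'rV[R[i]^o]_n) (alpha : R).

Definition mdeg k : nat := (\sum_(i < n) k i)%N.

Definition mfact k : nat := (\prod_(i < n) (k i)`!)%N.

Definition monomial k z : R[i] := \prod_(i < n) z 0 i ^+ k i.

(* Euclidean, whereas the norm of the library on 'rV[R[i]^o]_n is the sup norm
   (the two induce the same topology). *)
Definition unit_ball : set 'rV[R[i]^o]_n :=
  [set z | \sum_(i < n) (Normc.normc (z 0 i)) ^+ 2 < 1].

(* [differentiable] is relative to the scalars R[i]: the differential is
   C-linear. *)
Definition holomorphic_on_ball f : Prop :=
  forall z, unit_ball z -> differentiable f z.

(* The sum over all multi-indices is unconditional, i.e. the limit of the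
   finite partial sums along the directed set of finite sets of indices. *)
Definition has_expansion f a : Prop :=
  forall z, unit_ball z ->
    summability.partial_sum (fun k => (a k * monomial k z : R[i]^o))
      @ summability.totally --> f z.

(* The coefficients of an expansion on the ball are unique; junk value 0 when
   there is no expansion. *)
Definition taylor f : multiindex n -> R[i] :=
  xget (fun=> 0) [set a | has_expansion f a].

Definition weight alpha k : R :=
  (n + mdeg k)%N%:R `^ alpha
    * ((n - 1)`!%N%:R * (mfact k)%:R / (n - 1 + mdeg k)`!%N%:R).

Definition sqnorm alpha f : \bar R :=
  \esum_(k in setT) (weight alpha k * Normc.normc (taylor f k) ^+ 2)%:E.

Definition dirichlet alpha : set (cfun R n) :=
  [set f | [/\ holomorphic_on_ball f,
               exists a, has_expansion f a
             & (sqnorm alpha f < +oo)%E]].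

Definition monomial_span f : set (cfun R n) :=
  [set h | exists s : seq (R[i] * multiindex n),
     h = fun z => \sum_(x <- s) x.1 * (monomial x.2 z * f z)].

Definition dirichlet_closure alpha (S : set (cfun R n)) : set (cfun R n) :=
  [set g | dirichlet alpha g /\
     forall e : R, 0 < e ->
       exists2 h, S h & (sqnorm alpha (g \- h)%R < (e ^+ 2)%:E)%E].

(* To be used for f in [dirichlet alpha]. *)
Definition cyclic alpha f : Prop :=
  dirichlet_closure alpha (monomial_span f) = dirichlet alpha.

End DirichletTypeSpace.

Definition poly_p (R : realType) (n m : nat) : cfun R n :=
  fun z => 1 - (m%:R `^ (m%:R / 2))%:C * \prod_(i < n | (i < m)%N) z 0 i.
Arguments poly_p R n m : clear implicits.

(* Main.v *)
Require Import Defs.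
From mathcomp Require Import all_boot all_order all_algebra.
From mathcomp Require Import all_classical all_reals all_analysis.
From mathcomp Require Import finmap complex ring lra zify.
From mathcomp.analysis.showcase Require summability.
Import Order.TTheory GRing.Theory Num.Theory.
Import numFieldNormedType.Exports.
Local Open Scope classical_set_scope.
Local Open Scope ring_scope.

(** Non-cyclicity comes from a bounded linear functional that kills every
    polynomial multiple of p but not the constant 1.  On the sphere, p vanishes
    on the torus where |z_1| = ... = |z_m| = m^(-1/2), the product z_1...z_m is
    positive, and the other coordinates are 0.  The functional is the mean over
    this torus ([torus_mean]).  On a power series it reads off the coefficients
    of the powers of z_1...z_m:

      sum_k a_k z^k  |->  sum_l a_(l,...,l,0,...,0) m^(-ml/2),

    and in this form p is killed because the terms of index l and l+1 cancel
    ([torus_mean_monomial_shift]).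

    By Cauchy-Schwarz the functional is bounded on D_alpha as soon as the series
    of m^(-ml) / w(l,...,l,0,...,0) converges, where w is the weight of the norm.
    Since (ml)!/(l!)^m is of order m^(ml) l^(-(m-1)/2), the general term has
    order l^(n-1-alpha-(m-1)/2), and the exponent is less than -1 exactly when
    alpha > (2n+1-m)/2 ([sum_diag_weight_bounded]).  The bound on the multinomial
    coefficient follows from the ratio of consecutive terms, without Stirling's
    formula ([central_multinomial_le]).

    If p were cyclic, some polynomial multiple q p would be arbitrarily close to
    1; but 1 - q p has mean 1, so its norm is bounded below
    ([sqnorm_ge_torus_mean], [one_sub_span]).  Only polynomials are involved, yet
    the norm is defined through the coefficients of some unconditional expansion
    of the function on the ball, so that an identity theorem for such expansions
    is needed to know these coefficients ([has_expansion_inj]). *)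

Set Implicit Arguments.
Unset Strict Implicit.
Unset Printing Implicit Defensive.

(** * Unconditional sums of complex numbers *)

Section UnconditionalSums.
Context {R : realType} {I : choiceType}.
Implicit Types (x y : I -> R[i]^o) (J : {fset I}).

Lemma partial_sumE x J : summability.partial_sum x J = \sum_(i <- J) x i.
Proof. by rewrite /summability.partial_sum big_seq_fsetE. Qed.

Lemma cvg_totallyP x (l : R[i]^o) :
  summability.partial_sum x @ summability.totally --> l <->
  forall e : R[i], 0 < e -> exists A : {fset I}, forall J,
    (A `<=` J)%fset -> `|l - \sum_(i <- J) x i| <= e.
Proof.
split=> [/cvgrPdist_le xl e e0|xl].
  have [A _ AJ] := xl (summability.totally_filter) e e0.
  by exists A => J /AJ; rewrite /= partial_sumE.
apply/(@cvgrPdist_le _ _ _ _ summability.totally_filter) => e /xl[A AJ].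
by exists A => // J /AJ; rewrite /= partial_sumE.
Qed.

(** Convergence bounds the sums over the sets that contain some [A].  A sum over
    a set disjoint from [A] is the difference of two such sums, and the part of
    any sum inside [A] is at most the absolute sum over [A]. *)
Lemma bounded_partial_sums x (l : R[i]^o) :
  summability.partial_sum x @ summability.totally --> l ->
  exists M : R[i], forall J, `|\sum_(i <- J) x i| <= M.
Proof.
move=> /cvg_totallyP /(_ 1 ltr01)[A AJ].
exists (1 + 1 + \sum_(i <- A) `|x i|) => J.
have split_sum (F : I -> R[i]) (B : {fset I}) :
  \sum_(i <- B) F i = \sum_(i <- [fset i in B | i \in A]%fset) F i
                    + \sum_(i <- [fset i in B | i \notin A]%fset) F i.
  exact: (big_fsetID _ (mem A)).
pose B := (A `|` [fset i in J | i \notin A])%fset.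
have AB : (A `<=` B)%fset by rewrite fsubsetUl.
have sumB : \sum_(i <- B) x i = \sum_(i <- A) x i
    + \sum_(i <- [fset i in J | i \notin A]%fset) x i.
  rewrite split_sum; congr (_ + _); apply: eq_fbigl => i; rewrite !inE /=;
    by case: (i \in A); rewrite ?andbF ?andbT ?orbF.
rewrite split_sum addrC; apply: (le_trans (ler_normD _ _)); apply: lerD.
  have -> : \sum_(i <- [fset i in J | i \notin A]%fset) x i
     = (l - \sum_(i <- A) x i) - (l - \sum_(i <- B) x i).
    by rewrite sumB; ring.
  apply: (le_trans (ler_normB _ _)).
  by apply: lerD; apply: AJ.
apply: (le_trans (ler_norm_sum _ _ _)).
rewrite [leRHS](big_fsetID _ (mem J)) /=.
rewrite [X in X + _](_ : _ =
   \sum_(i <- [fset i in J | i \in A]%fset) `|x i|).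
  by rewrite lerDl sumr_ge0.
by apply: eq_fbigl => i; rewrite !inE /= andbC.
Qed.

(** The sum of the absolute values splits into the sums over the nonnegative
    and over the negative terms. *)
Lemma real_abs_bounded y (M : R[i]) : (forall i, y i \is Num.real) ->
  (forall J, `|\sum_(i <- J) y i| <= M) ->
  forall J, \sum_(i <- J) `|y i| <= M + M.
Proof.
move=> yR yM J; rewrite (big_fsetID _ (fun i => 0 <= y i)) /=; apply: lerD.
  rewrite (_ : \sum_(i <- _) _ = \sum_(i <- [fset i in J | (0 <= y i)%R]%fset) y i).
    apply: le_trans (yM _); apply: real_ler_norm; apply: rpred_sum => i _.
    exact: yR.
  rewrite !big_fset; apply: eq_bigr => i; exact: ger0_norm.
rewrite (_ : \sum_(i <- _) _ = - \sum_(i <- [fset i in J | ~~ (0 <= y i)%R]%fset) y i).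
  apply: le_trans (yM _); rewrite -normrN; apply: real_ler_norm.
  by rewrite rpredN; apply: rpred_sum => i _; exact: yR.
rewrite -sumrN !big_fset; apply: eq_bigr => i.
by rewrite -real_ltNge ?real0 ?yR// => /ltr0_norm.
Qed.

(** Unconditional convergence implies absolute convergence: [real_abs_bounded]
    applies to the real and imaginary parts. *)
Lemma abs_bounded x (l : R[i]^o) :
  summability.partial_sum x @ summability.totally --> l ->
  exists2 M : R[i], 0 <= M & forall J, \sum_(i <- J) `|x i| <= M.
Proof.
move=> /bounded_partial_sums[M xM].
have M0 : 0 <= M by apply: le_trans (xM fset0).
exists (M + M + (M + M)) => [|J]; first by rewrite !addr_ge0.
have Rebound (c : R[i]) : `|c| = 1 -> \sum_(i <- J) `|'Re (c * x i : R[i])| <= M + M.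
  move=> c1; apply: (real_abs_bounded (y := fun i => 'Re (c * x i : R[i]))) => [i|K].
    exact: Creal_Re.
  rewrite -raddf_sum /= -mulr_sumr; apply: le_trans (xM K).
  apply: le_trans (leif_normC_Re_Creal _).1 _.
  by rewrite normrM c1 mul1r.
apply: (@le_trans _ _ (\sum_(i <- J) (`|'Re (1 * x i : R[i])| + `|'Re ('i * x i : R[i])|))).
  apply: ler_sum => i _; rewrite ReMil normrN mul1r {1}[x i : R[i]]Crect.
  apply: le_trans (ler_normD _ _) _.
  by rewrite normrM normCi mul1r.
rewrite big_split /=; apply: lerD; apply: Rebound; first exact: normr1.
exact: normCi.
Qed.

(** Divided by t^(e i0), the sum is x i0 up to an error of at most t times the
    absolute sum of the coefficients; let t tend to 0. *)
Lemma least_exponent_eq0 x (e : I -> nat) i0 :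
  (forall t : R[i], 0 < t <= 1 ->
     summability.partial_sum (fun i => x i * t ^+ e i : R[i]^o)
       @ summability.totally --> (0 : R[i]^o)) ->
  (forall i, i != i0 -> x i != 0 -> (e i0 < e i)%N) ->
  x i0 = 0.
Proof.
move=> x0 e_min; apply/eqP; apply: contraT => xi0.
have [|M M0 xM] := @abs_bounded x 0.
  have := x0 1; rewrite ltr01 lexx => /(_ isT).
  by under [X in summability.partial_sum X]funext => i do rewrite expr1n mulr1.
pose c : R[i] := `|x i0|.
have c0 : 0 < c by rewrite normr_gt0.
have cM0 : 0 < c + M + 1 by rewrite ltr_wpDl ?addr_ge0// ltW.
(* The argument below yields c <= t (1 + M), which this t contradicts. *)
pose t := c / (c + M + 1).
have t0 : 0 < t by rewrite divr_gt0.
have t1 : t <= 1 by rewrite ler_pdivrMr// mul1r -addrA lerDl addr_ge0.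
have t01 : 0 < t <= 1 by rewrite t0.
have /cvg_totallyP/(_ (t ^+ (e i0).+1)) := x0 t t01.
rewrite exprn_gt0// => /(_ isT)[A AJ].
have {AJ} := AJ (i0 |` A)%fset (fsubsetU1 _ _).
rewrite sub0r normrN (big_fsetD1 i0) ?fset1U1//=.
set r := \sum_(i <- _) _ => small.
have rM : `|r| <= M * t ^+ (e i0).+1.
  apply: le_trans (ler_norm_sum _ _ _) _.
  apply: (@le_trans _ _ (\sum_(i <- ((i0 |` A) `\ i0)%fset) `|x i| * t ^+ (e i0).+1)).
    rewrite !big_seq; apply: ler_sum => i; rewrite !inE => /andP[ii0 _].
    rewrite normrM normrX (gtr0_norm t0).
    have [->|xi] := eqVneq (x i) 0; first by rewrite normr0 !mul0r.
    by rewrite ler_wpM2l// ler_wiXn2l// ?ltW//; apply: e_min.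
  by rewrite -mulr_suml ler_wpM2r// exprn_ge0// ltW.
have : c * t ^+ e i0 <= t ^+ (e i0).+1 + M * t ^+ (e i0).+1.
  rewrite -(gtr0_norm (exprn_gt0 (e i0) t0)) -normrM.
  rewrite -[X in `|X|](addrK r); apply: le_trans (ler_normB _ _) _.
  exact: lerD.
rewrite !exprS mulrA -mulrDl ler_pM2r ?exprn_gt0// -{1}[t]mul1r -mulrDl.
rewrite /t mulrCA -[leLHS]mulr1 ler_pM2l// ler_pdivlMr// mul1r.
rewrite -addrA [1 + M]addrC gerDr => c_le0.
by have := lt_le_trans c0 c_le0; rewrite ltxx.
Qed.

End UnconditionalSums.

(** * Uniqueness of digits *)

Section BaseExpansion.
Implicit Types (B n : nat).

Lemma digits_lt B n (f : nat -> nat) : (forall i, (i < n)%N -> (f i < B)%N) ->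
  (\sum_(i < n) f i * B ^ i < B ^ n)%N.
Proof.
elim: n => [|n IHn] fB; first by rewrite big_ord0 expn0.
rewrite big_ord_recr/= expnS.
have /IHn : forall i, (i < n)%N -> (f i < B)%N by move=> i /ltnW/fB.
move=> S_lt; have fnB := fB n (leqnn _).
apply: (@leq_trans ((f n).+1 * B ^ n)); last by rewrite leq_mul2r fnB orbT.
by rewrite mulSn -addSn leq_add2r.
Qed.

Lemma digits_inj B n (f g : nat -> nat) : (forall i, (i < n)%N -> (f i < B)%N) ->
  (forall i, (i < n)%N -> (g i < B)%N) ->
  (\sum_(i < n) f i * B ^ i = \sum_(i < n) g i * B ^ i)%N ->
  forall i, (i < n)%N -> f i = g i.
Proof.
elim: n => // n IHn fB gB.
have fB' i : (i < n)%N -> (f i < B)%N by move=> /ltnW/fB.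
have gB' i : (i < n)%N -> (g i < B)%N by move=> /ltnW/gB.
rewrite !big_ord_recr/= => fg.
have fgn : f n = g n.
  have := congr1 (fun m => m %/ B ^ n)%N fg.
  have B0 : (0 < B ^ n)%N by rewrite expn_gt0 (leq_ltn_trans _ (fB n (leqnn _))).
  by rewrite !divnDMl// !divn_small ?digits_lt.
move=> i; rewrite ltnS leq_eqVlt => /predU1P[->//|]; apply: IHn => //.
by move/eqP: fg; rewrite fgn eqn_add2r => /eqP.
Qed.

End BaseExpansion.

(** * Uniqueness of the coefficients of a power series *)

Section Uniqueness.
Context {R : realType} {n : nat}.
Implicit Types (a b : multiindex n -> R[i]) (k : multiindex n).

(** The number with base-[B] digits k_0, ..., k_(n-1), |k|, the degree leading:
    among multi-indices of degree less than [B] it compares degrees first and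
    separates multi-indices of equal degree. *)
Definition grading B k : nat := (\sum_(i < n) k i * (B ^ i + B ^ n))%N.

Lemma gradingE B k :
  grading B k = (\sum_(i < n) k i * B ^ i + mdeg k * B ^ n)%N.
Proof.
by rewrite /grading /mdeg big_distrl -big_split; apply: eq_bigr => i _; rewrite mulnDr.
Qed.

Lemma leq_mdeg k i : (k i <= mdeg k)%N.
Proof. by rewrite /mdeg (bigD1 i)//= leq_addr. Qed.

Lemma sum_digits_lt B k : (mdeg k < B)%N -> (\sum_(i < n) k i * B ^ i < B ^ n)%N.
Proof.
move=> kB; pose f j := if insub j is Some i then k i else 0%N.
have fE (i : 'I_n) : k i = f i by rewrite /f valK.
under eq_bigr => i _ do rewrite fE.
apply: (@digits_lt B n f) => i ni.
by rewrite /f insubT; apply: leq_ltn_trans (leq_mdeg _ _) kB.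
Qed.

Lemma sum_digits_inj B k k' : (mdeg k < B)%N -> (mdeg k' < B)%N ->
  (\sum_(i < n) k i * B ^ i = \sum_(i < n) k' i * B ^ i)%N -> k = k'.
Proof.
move=> kB k'B; pose f k j := if insub j is Some i then k i else 0%N.
have fE (k'' : multiindex n) (i : 'I_n) : k'' i = f k'' i by rewrite /f valK.
under eq_bigr => i _ do rewrite fE.
under [in RHS]eq_bigr => i _ do rewrite fE.
move=> kk'; apply/ffunP => i; rewrite !fE.
apply: (@digits_inj B n (f k) (f k')) => // j nj; rewrite /f insubT.
  exact: leq_ltn_trans (leq_mdeg _ _) kB.
exact: leq_ltn_trans (leq_mdeg _ _) k'B.
Qed.

Lemma monomial_powers (r t : R[i]) (w : 'I_n -> nat) k :
  monomial k (\row_i (r * t ^+ w i)) = r ^+ mdeg k * t ^+ (\sum_(i < n) k i * w i)%N.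
Proof.
rewrite /monomial /mdeg -!prodrXr -big_split/=; apply: eq_bigr => i _.
by rewrite mxE exprMn -exprM mulnC.
Qed.

Lemma powers_in_ball (t : R[i]) (w : 'I_n -> nat) : 0 < t <= 1 ->
  unit_ball (\row_i (n.+1%:R^-1 * t ^+ w i) : 'rV[R[i]^o]_n).
Proof.
move=> /andP[t0 t1]; rewrite /unit_ball /=.
have normE (x : R[i]) : (Normc.normc x)%:C%C = `|x| by case: x.
rewrite -ltcR rmorph_sum/=.
apply: (@le_lt_trans _ _ (\sum_(i < n) n.+1%:R^-1)).
  apply: ler_sum => i _; rewrite rmorphXn/= normE mxE.
  rewrite ger0_norm ?mulr_ge0 ?exprn_ge0 ?invr_ge0 ?ler0n// ?(ltW t0)//.
  have tw : n.+1%:R^-1 * t ^+ w i <= (n.+1%:R^-1 : R[i]).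
    by rewrite ler_piMr ?invr_ge0 ?ler0n// exprn_ile1// ltW.
  have n1 : (n.+1%:R^-1 : R[i]) <= 1 by rewrite invf_le1 ?ltr0n// ler1n.
  rewrite expr2 -[leRHS]mulr1; apply: ler_pM => //; rewrite ?(le_trans tw n1)//;
    by rewrite mulr_ge0 ?invr_ge0 ?ler0n// exprn_ge0// ltW.
rewrite sumr_const card_ord -[_ *+ n]mulr_natl ltr_pdivrMr ?ltr0n// rmorph1 mul1r.
by rewrite ltr_nat.
Qed.

(** Identity theorem for unconditional expansions.  Let D be the least degree of
    a nonzero coefficient of the difference.  On the curve
    z_i = r t^(B^i + B^n) with B = D + 1, the monomial z^k becomes
    r^|k| t^(grading B k), and the least exponent of t with a nonzero coefficient
    belongs to exactly one multi-index, so [least_exponent_eq0] applies. *)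
Lemma has_expansion_inj (f : cfun R n) a b :
  has_expansion f a -> has_expansion f b -> a = b.
Proof.
move=> fa fb; pose d k := a k - b k.
have dsum z : unit_ball z ->
  summability.partial_sum (fun k => d k * monomial k z : R[i]^o)
    @ summability.totally --> (0 : R[i]^o).
  move=> zball; rewrite -[X in _ --> X](subrr (f z)).
  rewrite (_ : summability.partial_sum _ =
      summability.partial_sum (fun k => a k * monomial k z : R[i]^o)
    - summability.partial_sum (fun k => b k * monomial k z : R[i]^o)).
    exact: (@cvgB _ _ _ _ summability.totally_filter _ _ _ _ (fa z zball) (fb z zball)).
  apply/funext => J; rewrite !fctE !partial_sumE -sumrB; apply: eq_bigr => k _.
  by rewrite /d mulrBl.
apply/funext => k1; apply/eqP; rewrite -subr_eq0; apply: contraT => dk1.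
have [|D /asboolP[k2 dk2 k2D] D_min] :=
  @ex_minnP (fun D => `[< exists2 k, d k != 0 & mdeg k = D >]).
  by exists (mdeg k1); apply/asboolP; exists k1.
have {}D_min k : d k != 0 -> (D <= mdeg k)%N.
  by move=> dk; apply: D_min; apply/asboolP; exists k.
have [|e /asboolP[k0 dk0 k0e] e_min] :=
  @ex_minnP (fun e => `[< exists2 k, d k != 0 & grading D.+1 k = e >]).
  by exists (grading D.+1 k1); apply/asboolP; exists k1.
have {}e_min k : d k != 0 -> (grading D.+1 k0 <= grading D.+1 k)%N.
  by move=> dk; rewrite k0e; apply: e_min; apply/asboolP; exists k.
(* A multi-index of larger degree has a larger grading than [k2]. *)
have mdegP k : d k != 0 -> grading D.+1 k = grading D.+1 k0 -> mdeg k = D.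
  move=> dk kk0; apply/eqP; rewrite eqn_leq D_min// andbT.
  have := e_min _ dk2; rewrite -kk0 !gradingE k2D.
  have : (mdeg k2 < D.+1)%N by rewrite k2D.
  move=> /sum_digits_lt ? ?; rewrite -ltnS.
  have : (mdeg k * D.+1 ^ n < D.+1 * D.+1 ^ n)%N by rewrite mulSn; lia.
  by rewrite ltn_mul2r => /andP[].
suff /eqP : (d k0 * n.+1%:R^-1 ^+ mdeg k0 : R[i]^o) = 0.
  by rewrite mulf_eq0 expf_eq0 invr_eq0 pnatr_eq0 andbF orbF (negbTE dk0).
apply: (@least_exponent_eq0 _ _ (fun k => d k * n.+1%:R^-1 ^+ mdeg k)
  (grading D.+1)) => [t t01|k kk0].
  have := dsum _ (powers_in_ball (fun i => D.+1 ^ i + D.+1 ^ n)%N t01).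
  rewrite (_ : (fun k => _) = (fun k => d k * n.+1%:R^-1 ^+ mdeg k
    * t ^+ grading D.+1 k))//.
  by apply/funext => k; rewrite monomial_powers mulrA.
rewrite mulf_eq0 => /norP[dk _]; rewrite ltn_neqAle e_min// andbT.
apply: contra kk0 => /eqP /esym kk0; apply/eqP.
have kD := mdegP _ dk kk0; have k0D := mdegP _ dk0 erefl.
apply: (@sum_digits_inj D.+1); rewrite ?kD ?k0D//.
by move/eqP: kk0; rewrite !gradingE kD k0D eqn_add2r => /eqP.
Qed.

End Uniqueness.

(** * Growth of central multinomial coefficients *)

Section Asymptotics.
Context {R : realType}.
Implicit Types (d s y alpha : R) (l m n : nat).

(** Multiplied by (y + 1)^d, this is 1 + d/(y + 1) <= ((y + 1)/y)^d, which
    follows from 1 + x <= exp x, used once for x = d/(y + 1) and once for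
    x = - 1/(y + 1). *)
Lemma powRN_step d y : 0 < d -> 0 < y ->
  d * (y + 1) `^ (- (1 + d)) <= y `^ (- d) - (y + 1) `^ (- d).
Proof.
move=> d0 y0; have y10 : 0 < y + 1 by rewrite addr_gt0.
have le_quot : expR (1 / (y + 1)) <= (y + 1) / y.
  rewrite -[leLHS]invrK -expRN -[leRHS]invf_div.
  rewrite lef_pV2 ?posrE ?expR_gt0 ?divr_gt0//.
  rewrite (_ : y / (y + 1) = 1 + - (1 / (y + 1))) ?expR_ge1Dx//.
  by field; rewrite gt_eqF.
have le_powR : 1 + d / (y + 1) <= ((y + 1) / y) `^ d.
  apply: (le_trans (expR_ge1Dx _)).
  rewrite (_ : d / (y + 1) = 1 / (y + 1) * d); last by field; rewrite gt_eqF.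
  rewrite expRM; apply: ge0_ler_powR => //; rewrite ?nnegrE ?expR_ge0 ?(ltW d0)//.
  by rewrite divr_ge0// ltW.
rewrite lerBrDl opprD powRD; last by rewrite (gt_eqF y10) implybT.
rewrite powR_inv1 ?(ltW y10)// mulrA -[X in X + _]mul1r -mulrDl.
apply: (le_trans (ler_wpM2r (powR_ge0 _ _) le_powR)).
rewrite !powRN powRM ?invr_ge0 ?(ltW y0) ?(ltW y10)// -powR_inv1 ?(ltW y0)// -powRrM mulN1r powRN.
by rewrite mulrAC mulfV ?mul1r// gt_eqF// powR_gt0.
Qed.

(** The p-series, by comparison with the telescoping series of
    [powRN_step]. *)
Lemma sum_powRN_le d L : 0 < d ->
  \sum_(l < L) l.+1%:R `^ (- (1 + d)) <= 1 + d^-1.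
Proof.
move=> d0; have dV0 : 0 <= d^-1 by rewrite invr_ge0 ltW.
case: L => [|L]; first by rewrite big_ord0 addr_ge0.
apply: (@le_trans _ _ (1 + d^-1 * (1 - L.+1%:R `^ (- d)))); last first.
  by rewrite lerD2l ler_piMr// gerBl powR_ge0.
elim: L => [|L IHL].
  by rewrite big_ord_recl big_ord0 !powR1 subrr mulr0.
rewrite big_ord_recr/=; have L0 : 0 < L.+1%:R :> R by [].
have := powRN_step d0 L0; rewrite natr1 mulrC -ler_pdivlMr// mulrC.
by move/(lerD IHL) => /le_trans; apply; rewrite -addrA -mulrDr addrA subrK.
Qed.

Lemma fact_addn N j : ((N + j)`! = N`! * \prod_(i < j) (N + i.+1))%N.
Proof.
elim: j => [|j IHj]; first by rewrite addn0 big_ord0 muln1.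
by rewrite big_ord_recr/= mulnA -IHj addnS factS mulnC.
Qed.

Lemma fact_addn_le N j : ((N + j)`! <= N`! * (N + j).+1 ^ j)%N.
Proof.
rewrite fact_addn leq_mul2l; apply/orP; right.
rewrite -[X in (_ ^ X)%N]card_ord -prod_nat_const; apply: leq_prod => i _.
by rewrite addnS ltnS leq_add2l ltnW.
Qed.

Lemma expRN_div_le l s : 0 <= s ->
  expR (- (s / l.+1%:R)) <= l.+2%:R `^ (- s) / l.+1%:R `^ (- s).
Proof.
move=> s0; have l0 : 0 < l.+1%:R :> R by [].
have q0 : 0 < l.+2%:R / l.+1%:R :> R by rewrite divr_gt0.
have le_exp : (l.+2%:R / l.+1%:R) `^ s <= expR (s / l.+1%:R).
  rewrite (_ : s / _ = 1 / l.+1%:R * s); last by rewrite mul1r mulrC.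
  rewrite expRM; apply: ge0_ler_powR; rewrite ?nnegrE ?expR_ge0 ?(ltW q0)//.
  apply: le_trans (expR_ge1Dx _); rewrite -(natr1 l.+1) mulrDl.
  by rewrite divff// gt_eqF.
rewrite expRN [leRHS](_ : _ = ((l.+2%:R / l.+1%:R) `^ s)^-1).
  by rewrite lef_pV2 ?posrE ?expR_gt0 ?powR_gt0.
rewrite powRM ?invr_ge0// -[l.+1%:R^-1]powR_inv1// -powRrM mulN1r invfM.
by rewrite -!powRN opprK.
Qed.

Lemma sum_sub_succ (x : R) j :
  \sum_(i < j) (x - i.+1%:R) = j%:R * x - j%:R * j.+1%:R / 2.
Proof.
elim: j => [|j IHj]; first by rewrite big_ord0; ring.
rewrite big_ord_recr/= IHj -[in RHS](natr1 j.+1) -(natr1 j); by field.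
Qed.

(** The factor ml + i + 1 is m(l + 1) (1 - (m - 1 - i)/(m(l + 1))), and
    1 - x <= exp(- x). *)
Lemma prod_shifts_le l m : (0 < m)%N ->
  \prod_(i < m) (m * l + i.+1)%:R <=
    (m%:R * l.+1%:R) ^+ m * expR (- ((m%:R - 1) / 2 / l.+1%:R)) :> R.
Proof.
move=> m0; have m_gt0 : 0 < m%:R :> R by rewrite ltr0n.
have l0 : 0 < l.+1%:R :> R by [].
apply: (@le_trans _ _
    (\prod_(i < m) (m%:R * l.+1%:R * expR (- ((m%:R - i.+1%:R) / (m%:R * l.+1%:R)))))).
  apply: ler_prod => i _; rewrite ler0n/=.
  apply: le_trans (ler_wpM2l _ (expR_ge1Dx _)); last by rewrite mulr_ge0.
  rewrite natrD natrM -[l.+1%:R]natr1 le_eqVlt; apply/orP; left; apply/eqP; field.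
  by rewrite natr1 !gt_eqF.
rewrite big_split/= prodr_const card_ord -expR_sum sumrN -mulr_suml sum_sub_succ.
rewrite ler_pM2l ?exprn_gt0 ?mulr_gt0// ler_expR le_eqVlt; apply/orP; left; apply/eqP.
by rewrite -(natr1 m); field; rewrite !gt_eqF.
Qed.

(** The ratio of consecutive values of (ml)!/(m^(ml) l!^m) is the product of the
    1 - i/(m(l+1)) over i < m, hence at most exp(-(m-1)/(2(l+1))), which is at
    most ((l+2)/(l+1))^(-(m-1)/2).  The exponent is that of Stirling's formula. *)
Lemma central_multinomial_le m l : (0 < m)%N ->
  (m * l)`!%:R <=
    m%:R ^+ (m * l) * l`!%:R ^+ m * l.+1%:R `^ (- ((m%:R - 1) / 2)) :> R.
Proof.
move=> m0; have s0 : 0 <= (m%:R - 1) / 2 :> R.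
  by rewrite divr_ge0// subr_ge0 ler1n.
elim: l => [|l IHl]; first by rewrite muln0 !expr0 expr1n powR1 !mulr1.
rewrite mulnS addnC fact_addn natrM natr_prod.
apply: le_trans (ler_pM _ _ IHl (prod_shifts_le _ m0)) _; rewrite ?prodr_ge0//.
have := expRN_div_le l s0; set E := expR _.
rewrite ler_pdivlMr ?powR_gt0// => El.
rewrite factS natrM !exprMn exprD [X in _ <= X](_ : _ =
  m%:R ^+ (m * l) * l`!%:R ^+ m * (m%:R ^+ m * l.+1%:R ^+ m) *
   l.+2%:R `^ (- ((m%:R - 1) / 2))); last by ring.
rewrite [leLHS](_ : _ = m%:R ^+ (m * l) * l`!%:R ^+ m * (m%:R ^+ m * l.+1%:R ^+ m) *
   (E * l.+1%:R `^ (- ((m%:R - 1) / 2)))); last by ring.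
by rewrite ler_wpM2l// ?mulr_ge0 ?exprn_ge0.
Qed.

Lemma powR_le_between (N x y r : R) : 0 < x -> x <= y <= N * x ->
  y `^ r <= N `^ `|r| * x `^ r.
Proof.
move=> x0 /andP[xy yNx]; have y0 := lt_le_trans x0 xy.
have q0 : 0 < y / x by rewrite divr_gt0.
have q1 : 1 <= y / x by rewrite ler_pdivlMr// mul1r.
rewrite -[in leLHS](divfK (lt0r_neq0 x0) y) powRM ?(ltW q0) ?(ltW x0)//.
rewrite ler_wpM2r ?powR_ge0//.
apply: le_trans (ler_powR q1 (ler_norm r)) _.
by apply: ge0_ler_powR; rewrite ?nnegrE ?ler_pdivrMr ?(ltW q0)// (le_trans (ltW q0))// ler_pdivrMr.
Qed.

End Asymptotics.

(** * The weights on the diagonal *)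

Lemma weight_gt0 (R : realType) (n : nat) (alpha : R) (k : multiindex n) :
  (0 < n)%N -> 0 < weight alpha k.
Proof.
move=> n_gt0; rewrite /weight mulr_gt0 ?powR_gt0 ?divr_gt0 ?mulr_gt0 ?ltr0n ?fact_gt0//.
  by rewrite addn_gt0 n_gt0.
by apply/prodn_gt0 => i; exact: fact_gt0.
Qed.

Section Diagonal.
Context {R : realType} (n m : nat).
Context (m_gt0 : (0 < m)%N) (le_mn : (m <= n)%N).
Implicit Types (alpha : R) (l : nat).

Definition diag l : multiindex n := [ffun i : 'I_n => if (i < m)%N then l else 0%N].

Lemma mdeg_diag l : mdeg (diag l) = (m * l)%N.
Proof.
rewrite /mdeg; under eq_bigr do rewrite ffunE.
by rewrite -big_mkcond/= (big_ord_narrow le_mn)/= sum_nat_const card_ord.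
Qed.

Lemma mfact_diag l : mfact (diag l) = (l`! ^ m)%N.
Proof.
rewrite /mfact; under eq_bigr do rewrite ffunE (fun_if factorial) fact0.
by rewrite -big_mkcond/= (big_ord_narrow le_mn)/= prod_nat_const card_ord.
Qed.

(** The factor (n-1+ml)!/(ml)! of the general term is of order l^(n-1), and
    (ml)!/(m^(ml) l!^m) of order l^(-(m-1)/2).  With (n+ml)^(-alpha) the general
    term is at most a constant times (l+1)^(-(1+d)), where
    d = (m-1)/2 + alpha - n is positive by the hypothesis on [alpha]. *)
Lemma sum_diag_weight_bounded alpha : (2 * n%:R + 1 - m%:R) / 2 < alpha ->
  exists2 B : R, 0 < B &
    forall L, \sum_(l < L) (m%:R ^+ (m * l))^-1 / weight alpha (diag l) <= B.
Proof.
move=> halpha; pose d := (m%:R - 1) / 2 + alpha - n%:R.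
have d0 : 0 < d by rewrite /d; lra.
pose r := n%:R - 1 - alpha; pose C := n%:R `^ `|r|.
have n0 : (0 < n)%N := leq_trans m_gt0 le_mn.
have C0 : 0 < C by rewrite powR_gt0 ?ltr0n.
exists (C * (1 + d^-1)) => [|L].
  by rewrite mulr_gt0// addr_gt0// invr_gt0.
apply: le_trans (ler_wpM2l (ltW C0) (sum_powRN_le _ d0)).
rewrite mulr_sumr; apply: ler_sum => l _.
rewrite ler_pdivrMr ?(weight_gt0 _ _ n0)// -[leLHS]mulr1 ler_pdivrMl ?exprn_gt0 ?ltr0n//.
rewrite /weight mfact_diag mdeg_diag subn1.
have nl0 : 0 < (n + m * l)%N%:R :> R by rewrite ltr0n addn_gt0 n0.
have := powR_le_between (N := n%:R) (x := l.+1%:R) (y := (n + m * l)%N%:R) r.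
rewrite -natrM !ler_nat.
have -> : (l.+1 <= n + m * l <= n * l.+1)%N by apply/andP; split; nia.
rewrite ltr0n => /(_ isT isT); rewrite -/C => le_C.
have le_t := @central_multinomial_le R m l m_gt0.
have le_f : (n.-1 + m * l)`!%:R <= (m * l)`!%:R * (n + m * l)%:R ^+ n.-1 :> R.
  rewrite -natrX -natrM ler_nat addnC; apply: leq_trans (fact_addn_le _ _) _.
  by rewrite -addnS prednK// [(m * l + n)%N]addnC.
have n1 : 1 <= n.-1`!%:R :> R by rewrite ler1n fact_gt0.
have f0 : 0 < (n.-1 + m * l)`!%:R :> R by rewrite ltr0n fact_gt0.
have powE : (n + m * l)%:R ^+ n.-1
    = (n + m * l)%:R `^ alpha * (n + m * l)%:R `^ r :> R.
  rewrite -powRD ?(gt_eqF nl0) ?implybT// -powR_mulrn ?(ltW nl0)//.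
  by congr (_ `^ _); rewrite -subn1 natrB// /r; ring.
have powlE : l.+1%:R `^ (- (1 + d)) = l.+1%:R `^ (- ((m%:R - 1) / 2)) * l.+1%:R `^ r :> R.
  have l0 : 0 < l.+1%:R :> R by [].
  by rewrite -powRD ?(gt_eqF l0) ?implybT//; congr (_ `^ _); rewrite /d /r; field.
rewrite powlE natrX !mulrA ler_pdivlMr// mul1r.
apply: (le_trans le_f); rewrite powE.
apply: le_trans (ler_wpM2r _ le_t) _; first by rewrite mulr_ge0 ?powR_ge0.
set T := (m%:R ^+ (m * l) * _) * _; set X := _ `^ alpha.
have TX0 : 0 <= T * X by rewrite !mulr_ge0 ?powR_ge0 ?exprn_ge0.
rewrite mulrA; apply: le_trans (ler_wpM2l TX0 le_C) _.
have Y0 : 0 <= T * X * (C * l.+1%:R `^ r) by rewrite mulr_ge0// mulr_ge0 ?powR_ge0 ?(ltW C0).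
apply: le_trans (ler_peMr Y0 n1) _; rewrite /T le_eqVlt; apply/orP; left; apply/eqP.
ring.
Qed.

End Diagonal.

(** * Polynomials as elements of D_alpha *)

Section Polynomials.
Context {R : realType} {n : nat}.
Implicit Types (s : seq (R[i] * multiindex n)) (k : multiindex n) (alpha : R).

(** Polynomials are lists of terms in which a multi-index may be repeated, so that
    sums and products by monomials are list operations. *)
Definition peval s : cfun R n := fun z => \sum_(x <- s) x.1 * monomial x.2 z.

Definition pcoef s k : R[i] := \sum_(x <- s | x.2 == k) x.1.

Definition madd k k' : multiindex n := [ffun i => (k i + k' i)%N].

Lemma mdeg_madd k k' : mdeg (madd k k') = (mdeg k + mdeg k')%N.
Proof. by rewrite /mdeg -big_split; apply: eq_bigr => i _; rewrite ffunE. Qed.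

Lemma monomial_madd k k' (z : 'rV[R[i]^o]_n) :
  monomial (madd k k') z = monomial k z * monomial k' z.
Proof.
by rewrite /monomial -big_split; apply: eq_bigr => i _; rewrite ffunE exprD.
Qed.

Lemma monomial0 (z : 'rV[R[i]^o]_n) : monomial [ffun=> 0%N] z = 1.
Proof. by rewrite /monomial big1// => i _; rewrite ffunE expr0. Qed.

Lemma differentiable_peval s z : differentiable (peval s) z.
Proof.
have diff_monomial k : differentiable (monomial k : cfun R n) z.
  rewrite (_ : monomial k =
    \prod_(i < n) ((fun y : 'rV[R[i]^o]_n => y 0 i) : cfun R n) ^+ k i); last first.
    apply/funext => y; rewrite fct_prodE; apply: eq_bigr => i _.
    by rewrite exprfctE.
  elim/big_ind : _ => [|f g|i _].
  - exact: differentiable_cst.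
  - exact: differentiableM.
  case: (k i) => [|j]; first exact: differentiable_cst.
  by apply: differentiableX; exact: differentiable_coord.
elim: s => [|x s IHs].
  rewrite (_ : peval [::] = cst 0); first exact: differentiable_cst.
  by apply/funext => y; rewrite /peval big_nil.
rewrite (_ : peval (x :: s) = x.1 *: (monomial x.2 : cfun R n) + peval s).
  apply: differentiableD IHs.
  exact: (@differentiableZ _ _ _ (monomial x.2 : cfun R n)).
by apply/funext => y; rewrite /peval big_cons.
Qed.

(** The partial sums are constant as soon as they contain every multi-index
    that occurs in [s]. *)
Lemma has_expansion_peval s : has_expansion (peval s) (pcoef s).
Proof.
move=> z _; apply/cvg_totallyP => e e0.
exists [fset x.2 | x in s]%fset => J sJ.
rewrite (_ : \sum_(k <- J) _ = peval s z) ?subrr ?normr0 ?ltW//.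
under eq_bigr => k _ do rewrite /pcoef mulr_suml big_mkcond.
rewrite exchange_big/= /peval [in LHS]big_seq [in RHS]big_seq.
apply: eq_bigr => x xs; rewrite (big_fsetD1 x.2)/=; last first.
  by apply: (fsubsetP sJ); apply/imfsetP; exists x.
rewrite eqxx big_seq big1 ?addr0// => k; rewrite !inE => /andP[kx _].
by rewrite eq_sym (negbTE kx).
Qed.

Lemma taylor_peval s : taylor (peval s) = pcoef s.
Proof.
apply: xget_unique => [|a sa]; first exact: has_expansion_peval.
exact: has_expansion_inj sa (@has_expansion_peval s).
Qed.

Lemma weight_ge0 alpha k : 0 <= weight alpha k.
Proof. by rewrite /weight mulr_ge0 ?powR_ge0// divr_ge0. Qed.

Lemma sqnorm_peval_lty alpha s : (sqnorm alpha (peval s) < +oo)%E.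
Proof.
rewrite /sqnorm taylor_peval.
pose r := undup (map snd s).
rewrite (eq_esum (b := fun k => if k \in [set` r]
    then (weight alpha k * Normc.normc (pcoef s k) ^+ 2)%:E else 0%E)).
  rewrite -esum_mkcond esum_fset; last first.
  - by move=> k _; rewrite lee_fin mulr_ge0// ?sqr_ge0// weight_ge0.
  - exact: finite_seq.
  by rewrite -fsbig_seq ?undup_uniq// sumEFin ltry.
move=> k _; case: ifPn => //; rewrite notin_setE/= mem_undup => /negP kr.
rewrite /pcoef big_seq_cond big_pred0 => [|x].
  by rewrite Normc.normc0 expr0n mulr0.
by apply/andP => -[xs /eqP xk]; move/negP : kr; apply; rewrite -xk map_f.
Qed.

Lemma sqnorm_ge_sum alpha (f : cfun R n) (r : seq (multiindex n)) : uniq r ->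
  ((\sum_(k <- r) weight alpha k * Normc.normc (taylor f k) ^+ 2)%:E
    <= sqnorm alpha f)%E.
Proof.
move=> r_uniq; apply: esum_ge; exists [set` r]; first by split=> //; exact: finite_seq.
by rewrite -fsbig_seq// sumEFin.
Qed.

Lemma dirichlet_peval alpha s : dirichlet alpha (peval s).
Proof.
split; [|by exists (pcoef s); exact: has_expansion_peval|exact: sqnorm_peval_lty].
by move=> z _; exact: differentiable_peval.
Qed.

End Polynomials.

(** * The mean over the torus in the zero set of p *)

Section TorusMean.
Context {R : realType} (n m : nat).
Context (m_gt0 : (0 < m)%N) (le_mn : (m <= n)%N).
Implicit Types (s : seq (R[i] * multiindex n)) (k : multiindex n) (alpha : R).

Let c : R := m%:R `^ (m%:R / 2).

Let c_gt0 : 0 < c. Proof. by rewrite powR_gt0 ?ltr0n. Qed.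

Let c_sqr : c ^+ 2 = m%:R ^+ m.
Proof. by rewrite -powR_mulrn ?powR_ge0// -powRrM divfK// powR_mulrn. Qed.

(** The mean of z^k over the torus where |z_1| = ... = |z_m| = m^(-1/2),
    c z_1...z_m = 1 and the other coordinates are 0: on it (z_1...z_m)^l is the
    constant c^(-l), and every other monomial averages to 0.  By degree,
    |k|/m is the only l for which z^k can be (z_1...z_m)^l. *)
Definition torus_mean_monomial k : R :=
  let l := (mdeg k %/ m)%N in if k == diag n m l then c ^- l else 0.

Definition torus_mean s : R[i] :=
  \sum_(x <- s) x.1 * (torus_mean_monomial x.2)%:C%C.

Lemma diag_inj : injective (diag n m).
Proof.
move=> l l' /(congr1 (@mdeg n)); rewrite !mdeg_diag// => /eqP.
by rewrite eqn_pmul2l// => /eqP.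
Qed.

Lemma torus_mean_monomial_diag l : torus_mean_monomial (diag n m l) = c ^- l.
Proof. by rewrite /torus_mean_monomial mdeg_diag// mulKn// eqxx. Qed.

(** The functional kills z^k (1 - c z_1...z_m). *)
Lemma torus_mean_monomial_shift k :
  c * torus_mean_monomial (madd k (diag n m 1)) = torus_mean_monomial k.
Proof.
rewrite /torus_mean_monomial mdeg_madd mdeg_diag// muln1 divnDr// divnn m_gt0 addn1.
rewrite [_ == _](_ : _ = (k == diag n m (mdeg k %/ m))).
  case: eqP => _; last by rewrite mulr0.
  by rewrite exprS invfM mulrA divff ?mul1r// gt_eqF.
apply/eqP/eqP => [|->]; last first.
  rewrite mdeg_diag// mulKn//.
  by apply/ffunP => i; rewrite !ffunE; case: ifP; rewrite ?addn1.
move=> /ffunP kE; apply/ffunP => i; have := kE i; rewrite !ffunE.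
by case: ifP => _; [rewrite addn1 => -[]|rewrite addn0].
Qed.

(** In terms of coefficients the functional no longer depends on how the
    polynomial is written as a list of terms. *)
Lemma torus_mean_coef s : exists L,
  torus_mean s = \sum_(l < L) pcoef s (diag n m l) * (c ^- l)%:C%C.
Proof.
pose L := (\max_(x <- s) mdeg x.2).+1; exists L.
under eq_bigr => l _ do rewrite /pcoef mulr_suml big_mkcond.
rewrite exchange_big/= /torus_mean [in LHS]big_seq [in RHS]big_seq.
apply: eq_bigr => x xs.
have lt_L : (mdeg x.2 %/ m < L)%N.
  rewrite ltnS (leq_trans (leq_div _ _))//.
  by rewrite (leq_bigmax_seq (F := fun x => mdeg x.2)).
rewrite /torus_mean_monomial; case: eqP => [xd|x_nd].
  rewrite (bigD1 (Ordinal lt_L))//= -xd eqxx big1 ?addr0// => l /eqP l_neq.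
  case: eqP => // xl; case: l_neq; apply/val_inj/diag_inj => /=.
  by rewrite -xl -xd.
rewrite rmorph0 mulr0 big1// => l _; case: eqP => // xl; case: x_nd.
by rewrite {2}xl mdeg_diag// mulKn.
Qed.

(** Cauchy-Schwarz for sums normalised by S >= 1, where S is the sum of the
    a i * u i.  The squares w i (B a i - u i / w i)^2 add up to
    B^2 P - 2 B S + Q, with P the sum to be bounded and Q <= B; hence
    B^2 P >= 2 B - B. *)
Lemma cauchy_schwarz_normalized (I : finType) (w a u : I -> R) (B : R) :
  0 < B -> (forall i, 0 < w i) -> 1 <= \sum_i a i * u i ->
  \sum_i u i ^+ 2 / w i <= B -> B^-1 <= \sum_i w i * a i ^+ 2.
Proof.
move=> B0 w0 S1 QB; set P := \sum_i _.
have : 0 <= \sum_i w i * (B * a i - u i / w i) ^+ 2.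
  by apply: sumr_ge0 => i _; rewrite mulr_ge0 ?sqr_ge0 ?ltW.
rewrite (eq_bigr (fun i => B ^+ 2 * (w i * a i ^+ 2) - (2 * B) * (a i * u i)
   + u i ^+ 2 / w i)); last by move=> i _; field; rewrite gt_eqF.
rewrite big_split sumrB/= -!mulr_sumr -/P => sq_ge0.
rewrite -[B^-1]mulr1 ler_pdivrMl// -(ler_pM2l B0).
have := ler_wpM2l (ltW B0) S1; nra.
Qed.

(** This expresses that the functional is bounded, with norm at most 1/e: it is
    Cauchy-Schwarz for the coefficients of index (l,...,l,0,...,0), by
    [sum_diag_weight_bounded]. *)
Lemma sqnorm_ge_torus_mean alpha : (2 * n%:R + 1 - m%:R) / 2 < alpha ->
  exists2 e : R, 0 < e & forall s, torus_mean s = 1 ->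
    ((e ^+ 2)%:E <= sqnorm alpha (peval s))%E.
Proof.
move=> /(sum_diag_weight_bounded m_gt0 le_mn)[B B0 boundB].
exists (Num.sqrt B)^-1 => [|s mean1]; first by rewrite invr_gt0 sqrtr_gt0.
have [L meanE] := torus_mean_coef s.
rewrite exprVn sqr_sqrtr ?(ltW B0)//.
pose r := [seq diag n m l | l <- iota 0 L].
have r_uniq : uniq r by rewrite map_inj_uniq ?iota_uniq//; exact: diag_inj.
apply: le_trans (sqnorm_ge_sum _ _ r_uniq); rewrite lee_fin taylor_peval.
rewrite big_map -[in iota 0 L](subn0 L) -/(index_iota 0 L) big_mkord.
apply: (cauchy_schwarz_normalized (u := fun l : 'I_L => c ^- l)) => // [l||].
- exact: weight_gt0 (leq_trans m_gt0 le_mn).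
- have normE (x : R[i]) : (Normc.normc x)%:C%C = `|x| by case: x.
  rewrite -lecR rmorph1 -(normr1 R[i]) -mean1 meanE rmorph_sum/=.
  apply: le_trans (ler_norm_sum _ _ _) _; apply: ler_sum => l _.
  rewrite rmorphM/= normE normrM ler_wpM2l// ger0_norm//.
  by rewrite ler0c invr_ge0 exprn_ge0// ltW.
apply: le_trans (boundB L); apply: ler_sum => l _.
by rewrite exprVn -exprM mulnC exprM c_sqr exprM.
Qed.

Lemma poly_p_peval :
  poly_p R n m = peval [:: (1, [ffun=> 0%N]); (- c%:C%C, diag n m 1)].
Proof.
apply/funext => z; rewrite /poly_p /peval big_cons big_seq1/= monomial0 mul1r mulNr.
congr (_ - _ * _); rewrite /monomial big_mkcond; apply: eq_bigr => i _.
by rewrite ffunE; case: ifP; rewrite ?expr0 ?expr1.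
Qed.

(** The functional kills q p for every polynomial q, and the mean of 1 is 1. *)
Lemma one_sub_span h : monomial_span (poly_p R n m) h ->
  exists2 s, torus_mean s = 1 & peval [:: (1, [ffun=> 0%N])] \- h = peval s.
Proof.
case=> q ->.
exists ((1, [ffun=> 0%N]) :: [seq (- x.1, x.2) | x <- q]
  ++ [seq (x.1 * c%:C%C, madd x.2 (diag n m 1)) | x <- q]).
  rewrite /torus_mean big_cons big_cat !big_map/= -big_split big1 => [|x _] /=.
    rewrite addr0 mul1r (_ : [ffun=> _] = diag n m 0).
      by rewrite torus_mean_monomial_diag expr0 invr1.
    by apply/ffunP => i; rewrite !ffunE if_same.
  by rewrite -mulrA -rmorphM/= torus_mean_monomial_shift mulNr addNr.
apply/funext => z; rewrite /= poly_p_peval /peval !big_cons big_nil addr0 big_cat/=.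
rewrite !big_map -big_split -sumrN/=; congr (_ + _); apply: eq_bigr => x _.
by rewrite monomial_madd monomial0; ring.
Qed.

End TorusMean.

Unset Implicit Arguments.

Theorem lemma15 (R : realType) (n m : nat) (alpha : R)
    (hm : (1 <= m <= n)%N) (halpha : (2 * n%:R + 1 - m%:R) / 2 < alpha) :
  dirichlet alpha (poly_p R n m) /\ ~ cyclic alpha (poly_p R n m).
Proof.
have /andP[m_gt0 le_mn] := hm.
split; first by rewrite poly_p_peval; exact: dirichlet_peval.
move=> p_cyclic; pose one : cfun R n := peval [:: (1, [ffun=> 0%N])].
have : dirichlet_closure alpha (monomial_span (poly_p R n m)) one.
  by rewrite p_cyclic; exact: dirichlet_peval.
case=> _; have [e e0 far] := sqnorm_ge_torus_mean m_gt0 le_mn halpha.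
case/(_ e e0) => h /(one_sub_span m_gt0 le_mn)[s mean1 ->].
by rewrite ltNge far.
Qed.
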